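(* Let $0<s_1<s_2$ and for $m\ge1$ let $\mathcal C_N$, $N=4m+1$, be the defect capacitance matrix. Then there exists $N_0$ such that for all such $N\ge N_0$, $\mathcal C_N$ has exactly one eigenvalue $\lambda^{(N)}$ in $\Gamma=\big(\frac2{s_2},\frac2{s_1}\big)$. Moreover, with $$\lambda_*:=\frac12\left(\frac{3}{s_1}+\frac{3}{s_2}-\sqrt{\frac{9}{s_1^2}-\frac{14}{s_1s_2}+\frac{9}{s_2^2}}\right)\in\Gamma,$$ there exist constants $A,B>0$ independent of $N$ such that $|\lambda^{(N)}-\lambda_*|<Ae^{-BN}$ for all such $N\ge N_0$. Consequently, for fixed $v_b,\delta>0$, the leading-order interface frequencies $\omega^{(N)}:=v_b\sqrt{\delta\lambda^{(N)}}$ satisfy $|\omega^{(N)}-\omega_*|<A'e^{-BN}$ for some $A'>0$ independent of $N$, where $\omega_*=v_b\sqrt{\delta\lambda_*}$.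
   Context: Set $\alpha=\frac1{s_1}+\frac1{s_2}$, $\beta_1=-\frac1{s_1}$, $\beta_2=-\frac1{s_2}$, $\eta=\frac2{s_2}$. The defect capacitance matrix $\mathcal C_N$ ($N=4m+1$) is the real symmetric tridiagonal matrix with diagonal entries $(\mathcal C_N)_{11}=(\mathcal C_N)_{NN}=\frac1{s_1}$, $(\mathcal C_N)_{2m+1,2m+1}=\eta$, $(\mathcal C_N)_{ii}=\alpha$ otherwise, and off-diagonal entries $(\mathcal C_N)_{i,i+1}=(\mathcal C_N)_{i+1,i}$ equal to $\beta_1$ ($i$ odd) and $\beta_2$ ($i$ even) for $1\le i\le 2m$, and $\beta_2$ ($i$ odd) and $\beta_1$ ($i$ even) for $2m+1\le i\le 4m$. In the high-contrast model, the subwavelength resonant frequencies of the chain are $v_b\sqrt{\delta\lambda}+O(\delta)$, $\lambda$ ranging over eigenvalues of the capacitance matrix, where $\delta$ is the density contrast and $v_b$ the wave speed in the resonators. *)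

(* Defs.v *)
From HB Require Import structures.
From mathcomp Require Import all_boot all_order all_algebra.
From mathcomp Require Import all_classical all_reals all_analysis.
Set Implicit Arguments. Unset Strict Implicit. Unset Printing Implicit Defensive.
Import Order.TTheory GRing.Theory Num.Theory.
Local Open Scope ring_scope.

Section Cap.
Variables (R : realType) (s1 s2 : R) (m : nat).

Definition alphaC : R := s1^-1 + s2^-1.
Definition beta1C : R := - s1^-1.
Definition beta2C : R := - s2^-1.
Definition etaC : R := 2 / s2.

(* diagonal entry at 1-based index k (1 <= k <= 4m+1) *)
Definition cap_diag (k : nat) : R :=
  if (k == 1)%N || (k == 4 * m + 1)%N then s1^-1
  else if (k == 2 * m + 1)%N then etaC
  else alphaC.

(* off-diagonal entry (k, k+1), 1-based k, 1 <= k <= 4m *)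
Definition cap_offdiag (k : nat) : R :=
  if (k <= 2 * m)%N then (if odd k then beta1C else beta2C)
  else (if odd k then beta2C else beta1C).

(* defect capacitance matrix C_N, N = 4m+1; entries indexed 0-based,
   entry (i,j) corresponds to the 1-based entry (i+1, j+1). *)
Definition defect_cap_matrix : 'M[R]_(4 * m + 1) :=
  \matrix_(i < 4 * m + 1, j < 4 * m + 1)
    if i == j :> nat then cap_diag i.+1
    else if j == i.+1 :> nat then cap_offdiag i.+1
    else if i == j.+1 :> nat then cap_offdiag j.+1
    else 0.
End Cap.

Definition lambda_star (R : realType) (s1 s2 : R) : R :=
  2^-1 * (3 / s1 + 3 / s2
          - Num.sqrt (9 / s1 ^+ 2 - 14 / (s1 * s2) + 9 / s2 ^+ 2)).

(* Main.v *)
Require Import Defs.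
From HB Require Import structures.
From mathcomp Require Import all_boot all_order all_algebra.
From mathcomp Require Import all_classical all_reals all_analysis.
From mathcomp Require Import ring lra zify.
Import Order.TTheory GRing.Theory Num.Theory.
Local Open Scope ring_scope.

(** Chebyshev polynomials p_k in the (negated) trace t of the two-site transfer
    matrix give the solution of the left half-chain in closed form; by reflection
    symmetry, lambda in the gap is an eigenvalue iff p_(m+1) = (3 - lambda s1) p_m.
    In the gap t > 2, so p_k grows exponentially. The invariant
    p_(m+1)^2 - t p_(m+1) p_m + p_m^2 = 1 turns the equation into
    (2 - lambda s1) q(lambda) = p_m^-2, where q is the quadratic whose smaller root
    is lambda_*: hence lambda < lambda_*, at a distance O(p_m^-2). There t increases
    with lambda, so p_(m+1) / p_m does too while 3 - lambda s1 decreases, which gives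
    uniqueness. Existence is the intermediate value theorem between the two ends of
    the gap, where t = 2 and p_k = k. The crude bound p_m >= m keeps the roots away
    from the edge 2/s2, and then t is bounded below by a constant above 2. *)

(** * Chebyshev recurrence: invariant, growth, monotonicity *)

(* [cheb t n] is U_(n-1)(t/2), with U the Chebyshev polynomials of the second kind. *)
Fixpoint cheb {A : nzRingType} (t : A) (n : nat) : A :=
  match n with
  | 0 => 0
  | S k => match k with 0 => 1 | S j => t * cheb t k - cheb t j end
  end.

Arguments cheb : simpl never.

Lemma cheb0 {A : nzRingType} (t : A) : cheb t 0 = 0.
Proof. by []. Qed.

Lemma cheb1 {A : nzRingType} (t : A) : cheb t 1 = 1.
Proof. by []. Qed.

Lemma chebSS {A : nzRingType} (t : A) (n : nat) :
  cheb t n.+2 = t * cheb t n.+1 - cheb t n.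
Proof. by []. Qed.

Lemma rmorph_cheb {A B : nzRingType} (f : {rmorphism A -> B}) (t : A) (n : nat) :
  f (cheb t n) = cheb (f t) n.
Proof.
suff: f (cheb t n) = cheb (f t) n /\ f (cheb t n.+1) = cheb (f t) n.+1 by case.
elim: n => [|n [IH0 IH1]]; first by rewrite !cheb0 !cheb1 rmorph0 rmorph1.
by split=> //; rewrite !chebSS rmorphB rmorphM IH0 IH1.
Qed.

(** The form x^2 - t x y + y^2 is symmetric and unchanged when y becomes t x - y, so the recurrence
    preserves its value at [n = 0]. *)
Lemma cheb_quadratic {A : comNzRingType} (t : A) (n : nat) :
  cheb t n.+1 ^+ 2 - t * cheb t n.+1 * cheb t n + cheb t n ^+ 2 = 1.
Proof.
elim: n => [|n IH]; first by rewrite cheb0 cheb1; ring.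
by rewrite -[RHS]IH chebSS; ring.
Qed.

Lemma cheb2 {A : comNzRingType} (n : nat) : cheb (2 : A) n = n%:R.
Proof.
suff: cheb (2 : A) n = n%:R /\ cheb (2 : A) n.+1 = n.+1%:R by case.
elim: n => [|n [IH0 IH1]] //; split=> //.
by rewrite chebSS IH0 IH1 -!natr1; ring.
Qed.

(** The increments start at 1 and never decrease: p_(n+2) - p_(n+1) = (t - 2) p_(n+1) + (p_(n+1) -
    p_n). *)
Lemma cheb_step {A : realDomainType} {t : A} (n : nat) :
  2 <= t -> 0 <= cheb t n /\ cheb t n + 1 <= cheb t n.+1.
Proof.
move=> t2; elim: n => [|n [IH0 IH1]]; first by rewrite cheb0 cheb1 add0r.
by rewrite chebSS; split; nra.
Qed.

Lemma cheb_gt0 {A : realDomainType} {t : A} (n : nat) : 2 <= t -> 0 < cheb t n.+1.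
Proof. by move=> /(cheb_step n) []; lra. Qed.

Lemma cheb_ge_nat {A : realDomainType} {t : A} (n : nat) :
  2 <= t -> n%:R <= cheb t n.
Proof.
move=> t2; elim: n => [|n IH] //=.
by rewrite -natr1; have [_] := cheb_step n t2; lra.
Qed.

(** Since p_n <= p_(n+1), each step multiplies by at least t - 1. *)
Lemma cheb_ge_expr {A : realDomainType} {t : A} (n : nat) :
  2 <= t -> (t - 1) ^+ n <= cheb t n.+1.
Proof.
move=> t2; elim: n => [|n IH] //.
rewrite exprS chebSS; have [] := cheb_step n t2; nra.
Qed.

(** The ratio r_n = p_(n+1) / p_n satisfies r_(n+1) = t - 1 / r_n, so it increases with t;
    cross-multiplying covers p_0 = 0. *)
Lemma cheb_ratio_homo {A : realDomainType} {s t : A} (n : nat) : 2 <= s -> s <= t ->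
  cheb s n.+1 * cheb t n <= cheb t n.+1 * cheb s n.
Proof.
move=> s2 st; elim: n => [|n IH]; first by rewrite cheb0 !mulr0.
have t2 : 2 <= t by lra.
rewrite !chebSS.
have := mulr_ge0 (ltW (cheb_gt0 n s2)) (ltW (cheb_gt0 n t2)).
move: IH; set a := cheb s n.+1; set b := cheb t n.+1.
by nra.
Qed.

(** * Rows of the matrix and the half-chain solution *)

(* Minus the trace of the transfer matrix across one cell of two resonators. *)
Definition cell_trace {R : pzRingType} (s1 s2 lam : R) : R :=
  2 * lam * (s1 + s2) - lam ^+ 2 * s1 * s2 - 2.

(* The solution, with value 1 at site 0, of the equations at the sites k < 2m
   (sites are numbered from 0). *)
Definition half_mode {R : nzRingType} (s1 s2 lam : R) (k : nat) : R :=
  let p := cheb (cell_trace s1 s2 lam) in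
  (-1) ^+ k./2 *
  (if odd k then (1 - lam * s1) * p k./2.+1 + p k./2
   else p k./2.+1 + (1 - lam * s1) * p k./2).

(** Vectors are functions on [nat], so that neighbouring sites need no bound proofs; the guards
    remove the missing neighbours at the two ends. *)
Definition cap_row {R : realType} (s1 s2 : R) (m : nat) (y : nat -> R) (j : nat) : R :=
  (if j == 0%N then 0 else cap_offdiag s1 s2 m j * y j.-1)
  + cap_diag s1 s2 m j.+1 * y j
  + (if j == (4 * m)%N then 0 else cap_offdiag s1 s2 m j.+1 * y j.+1).

Lemma mulmx_defect_cap {R : realType} (s1 s2 : R) (m : nat)
  (v : 'rV[R]_(4 * m + 1)) (y : nat -> R) :
  (forall i, v 0 i = y i) ->
  forall j, (v *m defect_cap_matrix s1 s2 m) 0 j = cap_row s1 s2 m y j.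
Proof.
move=> vy j; rewrite mxE.
transitivity (\sum_(i < 4 * m + 1)
   ((if (i.+1 == j :> nat) then cap_offdiag s1 s2 m i.+1 * y i else 0)
    + (if (i == j :> nat) then cap_diag s1 s2 m i.+1 * y i else 0)
    + (if (i == j.+1 :> nat) then cap_offdiag s1 s2 m j.+1 * y i else 0))).
  apply: eq_bigr => i _; rewrite mxE vy [j == i.+1 :> nat]eq_sym.
  case: (eqVneq (i : nat) j) => [->|_].
    by rewrite (gtn_eqF (ltnSn j)) (ltn_eqF (ltnSn j)) add0r addr0 mulrC.
  case: (eqVneq i.+1 (j : nat)) => [ij|_].
    by rewrite -ij ltn_eqF ?addr0 1?mulrC // ltnW.
  by case: ifP => _; rewrite ?mulr0 !add0r // mulrC.
rewrite !big_split /= -!big_mkcond /= (big_ord1_eq _ (fun i => cap_diag s1 s2 m i.+1 * y i)) ltn_ord.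
rewrite (big_ord1_eq _ (fun i => cap_offdiag s1 s2 m j.+1 * y i)) /cap_row.
congr (_ + _ + _); last first.
  move: (nat_of_ord j) (ltn_ord j) => {}j; rewrite !addn1 !ltnS leq_eqVlt.
  by case: eqVneq => [->|_ /= ->] //; rewrite ltnn.
case: (j : nat) (ltn_ord j) => [|k] kN; first by rewrite big_pred0.
by rewrite (big_ord1_eq _ (fun i => cap_offdiag s1 s2 m i.+1 * y i)) (ltnW kN).
Qed.

Lemma cap_diag_rev {R : realType} (s1 s2 : R) (m k : nat) : (k <= 4 * m)%N ->
  cap_diag s1 s2 m (4 * m - k).+1 = cap_diag s1 s2 m k.+1.
Proof.
move=> km; rewrite /cap_diag.
have -> : ((4 * m - k).+1 == 1)%N = (k.+1 == 4 * m + 1)%N by lia.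
have -> : ((4 * m - k).+1 == 4 * m + 1)%N = (k.+1 == 1)%N by lia.
have -> : ((4 * m - k).+1 == 2 * m + 1)%N = (k.+1 == 2 * m + 1)%N by lia.
by rewrite orbC.
Qed.

(** Link k+1 joins sites k and k+1; their mirror images 4m-k and 4m-k-1 are joined by link 4m-k. *)
Lemma cap_offdiag_rev {R : realType} (s1 s2 : R) (m k : nat) : (k < 4 * m)%N ->
  cap_offdiag s1 s2 m (4 * m - k) = cap_offdiag s1 s2 m k.+1.
Proof.
move=> km; rewrite /cap_offdiag oddB; last exact: ltnW.
have -> : (4 * m - k <= 2 * m)%N = ~~ (k < 2 * m)%N by lia.
by rewrite oddM /=; case: ltnP; case: (odd k).
Qed.

Lemma cap_row_rev {R : realType} (s1 s2 : R) (m : nat) (y : nat -> R) (j : nat) :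
  (j <= 4 * m)%N ->
  cap_row s1 s2 m (fun k => y (4 * m - k)%N) j = cap_row s1 s2 m y (4 * m - j).
Proof.
move=> jm; rewrite /cap_row cap_diag_rev // addrAC [RHS]addrC addrA.
have -> : (4 * m - j == 0)%N = (j == 4 * m)%N by lia.
have -> : (4 * m - j == 4 * m)%N = (j == 0)%N by lia.
congr (_ + _ + _); case: eqVneq => // jn; last first.
  by rewrite cap_offdiag_rev; [congr (_ * y _); lia | lia].
have -> : (4 * m - j).+1 = (4 * m - j.-1)%N by lia.
by rewrite cap_offdiag_rev ?prednK //; lia.
Qed.

Lemma eq_cap_row {R : realType} (s1 s2 : R) (m : nat) (x y : nat -> R) (j : nat) :
  (forall k, (k <= j.+1)%N -> x k = y k) -> cap_row s1 s2 m x j = cap_row s1 s2 m y j.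
Proof.
move=> xy; rewrite /cap_row !xy //.
by rewrite (leq_trans (leq_pred j)).
Qed.

Lemma cap_row_half_mode {R : realType} (s1 s2 lam : R) (m j : nat) :
  s1 != 0 -> s2 != 0 -> (j < 2 * m)%N ->
  cap_row s1 s2 m (half_mode s1 s2 lam) j = lam * half_mode s1 s2 lam j.
Proof.
move=> s10 s20 jm.
rewrite /cap_row /cap_diag /cap_offdiag /half_mode jm (ltnW jm).
have -> : (j == 4 * m)%N = false by lia.
have -> : (j.+1 == 4 * m + 1)%N = false by lia.
have -> : (j.+1 == 2 * m + 1)%N = false by lia.
rewrite /alphaC /beta1C /beta2C.
have [k [->|->]] : exists k, j = k.*2 \/ j = k.*2.+1.
- by exists j./2; rewrite -{1 3}[j]odd_double_half; case: (odd j); [right|left].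
- case: k => [|k]; rewrite ?doubleS /= ?odd_double /= ?uphalf_double ?doubleK.
    by rewrite cheb0 cheb1; field.
  by rewrite !chebSS exprS /cell_trace; field; rewrite s10 s20.
- rewrite /= !odd_double /= uphalf_double doubleK !chebSS exprS /cell_trace.
  by field; rewrite s10 s20.
Qed.

Lemma cap_offdiag_neq0 {R : realType} (s1 s2 : R) (m j : nat) :
  s1 != 0 -> s2 != 0 -> cap_offdiag s1 s2 m j != 0.
Proof.
move=> s10 s20; rewrite /cap_offdiag /beta1C /beta2C.
by case: ifP => _; case: ifP => _; rewrite oppr_eq0 invr_eq0.
Qed.

(** The off-diagonal entries do not vanish, so each row determines the next value: the solutions on
    the left half form a line. *)
Lemma half_modeP {R : realType} (s1 s2 lam : R) (m : nat) (y : nat -> R) :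
  s1 != 0 -> s2 != 0 ->
  (forall j, (j < 2 * m)%N -> cap_row s1 s2 m y j = lam * y j) ->
  forall j, (j <= 2 * m)%N -> y j = y 0%N * half_mode s1 s2 lam j.
Proof.
move=> s10 s20 rowy; set w := half_mode s1 s2 lam.
suff H j : ((j <= 2 * m)%N -> y j = y 0%N * w j) /\
           ((j < 2 * m)%N -> y j.+1 = y 0%N * w j.+1).
  by move=> j; have [] := H j.
elim: j => [|j [IH0 IH1]].
  have w0 : y 0%N = y 0%N * w 0%N by rewrite /w /half_mode /= cheb0 cheb1; ring.
  split=> // m0; apply: (mulfI (cap_offdiag_neq0 s1 s2 m 1 s10 s20)).
  have := congr1 ( *%R (y 0%N)) (cap_row_half_mode s1 s2 lam m 0 s10 s20 m0).
  move: (rowy _ m0); rewrite -/w /cap_row /= (_ : (0 == 4 * m)%N = false); last by lia.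
  have -> : w 0%N = 1 by rewrite /w /half_mode /= cheb0 cheb1; ring.
  by lra.
split=> // jm.
have e1 := rowy _ jm; have e2 := cap_row_half_mode s1 s2 lam m j.+1 s10 s20 jm.
apply: (mulfI (cap_offdiag_neq0 s1 s2 m j.+2 s10 s20)).
move: e1 (congr1 ( *%R (y 0%N)) e2); rewrite -/w /cap_row /=.
have -> : (j.+1 == 4 * m)%N = false by lia.
rewrite (IH0 (ltnW (ltnW jm))) (IH1 (ltnW jm)).
lra.
Qed.

(** The index [minn k (4 * m - k)] extends the half mode evenly; this is its residual in the central
    equation. *)
Lemma cap_row_center {R : realType} (s1 s2 lam : R) (m : nat) :
  s1 != 0 -> s2 != 0 -> (0 < m)%N ->
  let w := half_mode s1 s2 lam in
  let p := cheb (cell_trace s1 s2 lam) in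
  cap_row s1 s2 m (fun k => w (minn k (4 * m - k))) (2 * m) - lam * w (2 * m)%N
  = (-1) ^+ m * (lam * ((3 - lam * s1) * p m - p m.+1)).
Proof.
move=> s10 s20; case: m => // n _ w p; rewrite /cap_row.
have -> : (2 * n.+1 == 0)%N = false by lia.
have -> : (2 * n.+1 == 4 * n.+1)%N = false by lia.
have -> : minn (2 * n.+1) (4 * n.+1 - 2 * n.+1) = n.+1.*2 by lia.
have -> : minn (2 * n.+1).-1 (4 * n.+1 - (2 * n.+1).-1) = n.*2.+1 by lia.
have -> : minn (2 * n.+1).+1 (4 * n.+1 - (2 * n.+1).+1) = n.*2.+1 by lia.
rewrite /cap_diag /cap_offdiag.
have -> : ((2 * n.+1).+1 == 1)%N = false by lia.
have -> : ((2 * n.+1).+1 == 4 * n.+1 + 1)%N = false by lia.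
have -> : ((2 * n.+1).+1 == 2 * n.+1 + 1)%N by lia.
rewrite mul2n leqnn ltnn /= odd_double /= /beta2C /etaC.
rewrite /w /half_mode /= odd_double /= uphalf_double doubleK -/p.
have -> : p n.+2 = cell_trace s1 s2 lam * p n.+1 - p n by [].
rewrite exprS /cell_trace.
by field; rewrite s20.
Qed.

(** * The eigenvalue equation in the gap *)

(** Indeed t - 2 = (lam s2 - 2) (2 - lam s1). *)
Lemma cell_trace_gt2 {R : realType} {s1 s2 lam : R} :
  2 < lam * s2 -> lam * s1 < 2 -> 2 < cell_trace s1 s2 lam.
Proof. by rewrite /cell_trace => h2 h1; nra. Qed.

(** Up to sign the value is p_(m+1) + (1 - lam s1) p_m, which is at least 1 because 1 - lam s1 > -1
    and p_(m+1) >= p_m + 1. *)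
Lemma half_mode_center_neq0 {R : realType} {s1 s2 lam : R} (m : nat) :
  2 < lam * s2 -> lam * s1 < 2 -> half_mode s1 s2 lam (2 * m) != 0.
Proof.
move=> h2 h1; rewrite /half_mode mul2n odd_double doubleK mulf_neq0 ?signr_eq0 //.
have [] := cheb_step m (ltW (cell_trace_gt2 h2 h1)) => p0 p1.
by rewrite gt_eqF //; nra.
Qed.

(* The matrix commutes with the reflection k |-> 4m-k, and in the gap the half
   mode does not vanish at the centre: so eigenvectors are even, and only the
   equation at the centre constrains lam. *)
Lemma eigenvalue_gapP {R : realType} {s1 s2 lam : R} {m : nat} :
  0 < s1 -> 0 < s2 -> (0 < m)%N -> 2 < lam * s2 -> lam * s1 < 2 ->
  eigenvalue (defect_cap_matrix s1 s2 m) lam <->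
  cheb (cell_trace s1 s2 lam) m.+1 =
    (3 - lam * s1) * cheb (cell_trace s1 s2 lam) m.
Proof.
move=> s1_gt0 s2_gt0 m_gt0 h2 h1.
have s10 := lt0r_neq0 s1_gt0; have s20 := lt0r_neq0 s2_gt0.
have lam0 : lam != 0 by apply: contraTneq h2 => ->; rewrite mul0r -leNgt.
have leN (i : 'I_(4 * m + 1)) : (i <= 4 * m)%N by have := ltn_ord i; clear; lia.
have half_le j : (j < 2 * m)%N -> (j <= 4 * m)%N by clear; lia.
have center := cap_row_center s1 s2 lam m s10 s20 m_gt0.
have mode0 := half_mode_center_neq0 m h2 h1.
have row_mode := cap_row_half_mode s1 s2 lam m _ s10 s20.
have w0 : half_mode s1 s2 lam 0 = 1.
  by rewrite /half_mode /= cheb0 cheb1; ring.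
set w := half_mode s1 s2 lam in center mode0 row_mode w0 *.
rewrite /= in center.
set W := fun k => w (minn k (4 * m - k)) in center.
split.
  move=> /eigenvalueP[v vC v0].
  pose y k := oapp (fun i : 'I_(4 * m + 1) => v 0 i) 0 (insub k).
  have vy i : v 0 i = y i by rewrite /y valK.
  have rowy j : (j <= 4 * m)%N -> cap_row s1 s2 m y j = lam * y j.
    move=> jm0; have jm : (j < 4 * m + 1)%N by rewrite addn1 ltnS.
    by rewrite -(mulmx_defect_cap _ _ _ _ _ vy (Ordinal jm)) vC mxE vy.
  have yL := half_modeP s1 s2 lam m y s10 s20 (fun j jm => rowy j (half_le j jm)).
  (* The reversed vector solves the same equations on the left half. *)
  have yR : forall j, (j <= 2 * m)%N -> y (4 * m - j)%N = y (4 * m)%N * w j.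
    move=> j jm.
    rewrite (half_modeP s1 s2 lam m (fun k => y (4 * m - k)%N)) ?subn0 //.
    by move=> k km; rewrite cap_row_rev ?rowy //; clear -km; lia.
  (* Both halves share the central value, where the mode is nonzero. *)
  have ends : y (4 * m)%N = y 0%N.
    apply: (mulIf mode0); rewrite -yL // -yR //.
    by congr y; clear; lia.
  have yW k : (k <= 4 * m)%N -> y k = y 0%N * W k.
    move=> km; rewrite /W; have [kc|kc] := leqP k (2 * m).
      have -> : minn k (4 * m - k) = k by clear -kc; lia.
      exact: yL.
    have -> : minn k (4 * m - k) = (4 * m - k)%N by clear -kc; lia.
    by rewrite -ends -yR ?subKn //; clear -kc; lia.
  have y00 : y 0%N != 0.
    apply: contraNneq v0 => y00; apply/eqP/rowP => i.
    by rewrite vy yW ?y00 ?mul0r ?mxE.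
  have e : cap_row s1 s2 m y (2 * m) = y 0%N * cap_row s1 s2 m W (2 * m).
    rewrite (eq_cap_row _ _ _ _ (fun k => y 0%N * W k)).
      by rewrite /cap_row; case: ifP => _; case: ifP => _; ring.
    by move=> k km; apply: yW; clear -km m_gt0; lia.
  have cN : (2 * m <= 4 * m)%N by clear; lia.
  move: e; rewrite (rowy _ cN) (yW _ cN).
  have -> : W (2 * m)%N = w (2 * m)%N by rewrite /W; congr w; clear; lia.
  rewrite mulrCA => /(mulfI y00) e; move: center; rewrite -e subrr => /esym/eqP.
  by rewrite !mulf_eq0 signr_eq0 (negbTE lam0) subr_eq0 => /eqP.
move=> e; apply/eigenvalueP; exists (\row_(i < 4 * m + 1) W i); last first.
  have N0 : (0 < 4 * m + 1)%N by clear; lia.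
  apply/eqP => /rowP /(_ (Ordinal N0)) /eqP.
  by rewrite !mxE /W /= min0n w0 oner_eq0.
have rowL j : (j < 2 * m)%N -> cap_row s1 s2 m W j = lam * W j.
  move=> jm; rewrite (eq_cap_row _ _ _ _ w); first last.
    by move=> k kj; rewrite /W; congr w; clear -kj jm; lia.
  by rewrite row_mode // /W; congr (_ * w _); clear -jm; lia.
have Wrev j : (j <= 4 * m)%N -> W (4 * m - j)%N = W j.
  by move=> jm; rewrite /W subKn // minnC.
apply/rowP => j; rewrite (mulmx_defect_cap _ _ _ _ W); last by move=> i; rewrite mxE.
rewrite !mxE; move: (leN j); move: (nat_of_ord j) => {}j jm.
have [|jc|->] := ltngtP j (2 * m); first exact: rowL.
  (* A row right of the centre mirrors a row on the left. *)
  rewrite -[j in LHS](subKn jm) -cap_row_rev ?leq_subr //.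
  rewrite -Wrev // -rowL; last by clear -jm jc; lia.
  by apply: eq_cap_row => k kj; apply: Wrev; clear -kj jc jm; lia.
move/eqP: center; rewrite -e subrr !mulr0 subr_eq0 => /eqP ->.
by rewrite /W; congr (_ * w _); clear; lia.
Qed.

(** * The limit [lambda_star] and the distance of roots to it *)

(** With a = 1/s1, b = 1/s2 and r = sqrt D, the bounds say a + b < r < 3a - b, and D - (a + b)^2 = 8
    (a - b)^2, (3a - b)^2 - D = 8 b (a - b). *)
Lemma lambda_star_bounds {R : realType} {s1 s2 : R} : 0 < s1 -> s1 < s2 ->
  2 / s2 < lambda_star s1 s2 < s1^-1 + s2^-1.
Proof.
move=> s1_gt0 s12; have s2_gt0 : 0 < s2 by lra.
rewrite /lambda_star.
have b_gt0 : 0 < s2^-1 by rewrite invr_gt0.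
have ab : s2^-1 < s1^-1 by rewrite ltf_pV2.
have -> : 9 / s1 ^+ 2 - 14 / (s1 * s2) + 9 / s2 ^+ 2 =
    9 * s1^-1 ^+ 2 - 14 * (s1^-1 * s2^-1) + 9 * s2^-1 ^+ 2.
  by rewrite !exprVn [(s1 * s2)^-1]invfM.
move: s1^-1 s2^-1 b_gt0 ab => a b b_gt0 ab.
set D := 9 * a ^+ 2 - 14 * (a * b) + 9 * b ^+ 2.
have D_gt0 : 0 <= D by rewrite /D; nra.
have r0 := sqrtr_ge0 D; have := sqr_sqrtr D_gt0.
move: (Num.sqrt D) r0 => r r0 rD; rewrite /D in rD.
by apply/andP; split; nra.
Qed.

(* Its smaller root is [lambda_star], see [defect_quad_factor]. *)
Definition defect_quad {R : pzRingType} (s1 s2 lam : R) : R :=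
  lam ^+ 2 * s1 * s2 - 3 * lam * (s1 + s2) + 8.

(** Completing the square gives a difference of squares; the last factor comes from the conjugate
    root. *)
Lemma defect_quad_factor {R : realType} (s1 s2 lam : R) : 0 < s1 -> 0 < s2 ->
  let mu := lambda_star s1 s2 in
  defect_quad s1 s2 lam = s1 * s2 * (mu - lam) * (3 / s1 + 3 / s2 - mu - lam).
Proof.
move=> s1_gt0 s2_gt0; rewrite /lambda_star /defect_quad /=.
set D := 9 / s1 ^+ 2 - 14 / (s1 * s2) + 9 / s2 ^+ 2.
have D_ge0 : 0 <= D.
  have -> : D = 7 * (s1^-1 - s2^-1) ^+ 2 + 2 * s1^-1 ^+ 2 + 2 * s2^-1 ^+ 2.
    by rewrite /D; field; rewrite !lt0r_neq0.
  have := sqr_ge0 (s1^-1 - s2^-1); have := sqr_ge0 s1^-1; have := sqr_ge0 s2^-1.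
  by lra.
have := sqr_sqrtr D_ge0; move: (Num.sqrt D) => r rD.
transitivity (s1 * s2 * ((3 / s1 + 3 / s2 - 2 * lam) ^+ 2 - r ^+ 2) / 4).
  by rewrite rD /D; field; rewrite !lt0r_neq0.
by field; rewrite !lt0r_neq0.
Qed.

(** The trace is a concave parabola in [lam] with vertex 1/s1 + 1/s2, the midpoint of the gap. *)
Lemma cell_trace_homo {R : realType} {s1 s2 lam mu : R} : 0 < s1 -> 0 < s2 ->
  lam < mu -> mu <= s1^-1 + s2^-1 -> cell_trace s1 s2 lam < cell_trace s1 s2 mu.
Proof.
move=> s1_gt0 s2_gt0 lm mu_le.
have : mu * (s1 * s2) <= s1 + s2.
  apply: (le_trans (ler_wpM2r _ mu_le)); first by rewrite mulr_ge0 // ltW.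
  by rewrite le_eqVlt; apply/orP; left; apply/eqP; field; rewrite !lt0r_neq0.
have : lam * (s1 * s2) < mu * (s1 * s2) by rewrite ltr_pM2r // mulr_gt0.
move=> h1 h2; rewrite -subr_gt0 /cell_trace.
have -> : 2 * mu * (s1 + s2) - mu ^+ 2 * s1 * s2 - 2 -
  (2 * lam * (s1 + s2) - lam ^+ 2 * s1 * s2 - 2) =
  (mu - lam) * (2 * (s1 + s2) - mu * (s1 * s2) - lam * (s1 * s2)).
  by ring.
by rewrite mulr_gt0 //; lra.
Qed.

(* At such a root the invariant of the Chebyshev recurrence reads
   [(2 - lam s1) * defect_quad lam * p_m ^+ 2 = 1]. *)
Lemma cheb_root_dist {R : realType} {s1 s2 lam : R} {m : nat} :
  0 < s1 -> s1 < s2 -> 2 < lam * s2 -> lam * s1 < 2 ->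
  let p := cheb (cell_trace s1 s2 lam) in
  p m.+1 = (3 - lam * s1) * p m ->
  lam < lambda_star s1 s2 /\
  (lambda_star s1 s2 - lam) * p m ^+ 2 <= s2 / (s2 ^+ 2 - s1 ^+ 2).
Proof.
move=> s1_gt0 s12 h2 h1 p pm; have s2_gt0 : 0 < s2 by lra.
have /andP[mu_gt mu_lt] := lambda_star_bounds s1_gt0 s12.
have := cheb_quadratic (cell_trace s1 s2 lam) m; rewrite -/p pm => e.
have {}e : (2 - lam * s1) * defect_quad s1 s2 lam * p m ^+ 2 = 1.
  by rewrite -[RHS]e /defect_quad /cell_trace; ring.
move: e; rewrite defect_quad_factor //.
set mu := lambda_star s1 s2 in mu_gt mu_lt *; move: (p m) => q e.
have a_gt0 : 0 < s1^-1 by rewrite invr_gt0.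
have b_gt0 : 0 < s2^-1 by rewrite invr_gt0.
have lam_lt : lam < 2 / s1 by rewrite ltr_pdivlMr.
have conj_gt : 0 < 3 / s1 + 3 / s2 - mu - lam by lra.
(* Otherwise the left side of [e] would be nonpositive, yet it equals 1. *)
have lam_mu : lam < mu.
  rewrite ltNge; apply/negP => mu_le; suff : (1 : R) <= 0 by rewrite ler10.
  rewrite -e; apply: mulr_le0_ge0 (sqr_ge0 q).
  apply: mulr_ge0_le0; first by lra.
  apply: mulr_le0_ge0 (ltW conj_gt).
  by apply: mulr_ge0_le0; [rewrite mulr_ge0 // ltW | lra].
split=> //.
have d_gt0 : 0 < s2 ^+ 2 - s1 ^+ 2 by nra.
rewrite ler_pdivlMr // -[leRHS]mulr1 -e.
(* The lower bounds [two_sub] and [conj_ge] multiply to s2^2 - s1^2; both use lam < mu < 1/s1 +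
   1/s2. *)
have two_sub : s2 - s1 <= s2 * (2 - lam * s1).
  have : lam * (s1 * s2) < (s1^-1 + s2^-1) * (s1 * s2).
    by rewrite ltr_pM2r ?mulr_gt0 //; lra.
  have -> : (s1^-1 + s2^-1) * (s1 * s2) = s1 + s2 by field; rewrite !lt0r_neq0.
  by nra.
have conj_ge : s1 + s2 <= s1 * s2 * (3 / s1 + 3 / s2 - mu - lam).
  have -> : s1 + s2 = s1 * s2 * (s1^-1 + s2^-1) by field; rewrite !lt0r_neq0.
  by rewrite ler_wpM2l ?mulr_ge0 ?ltW //; lra.
have -> : (mu - lam) * q ^+ 2 * (s2 ^+ 2 - s1 ^+ 2) =
  (s2 - s1) * (s1 + s2) * ((mu - lam) * q ^+ 2) by ring.
have -> : forall c, s2 * ((2 - lam * s1) * (s1 * s2 * (mu - lam) * c) * q ^+ 2) =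
  s2 * (2 - lam * s1) * (s1 * s2 * c) * ((mu - lam) * q ^+ 2) by move=> c; ring.
apply: ler_wpM2r; first by rewrite mulr_ge0 ?sqr_ge0 // subr_ge0 ltW.
by apply: ler_pM => //; lra.
Qed.

(** * Uniqueness and existence of the root *)

Lemma cheb_root_unique {R : realType} {s1 s2 lam mu : R} {m : nat} :
  0 < s1 -> s1 < s2 ->
  2 < lam * s2 -> lam * s1 < 2 -> 2 < mu * s2 -> mu * s1 < 2 ->
  cheb (cell_trace s1 s2 lam) m.+1 = (3 - lam * s1) * cheb (cell_trace s1 s2 lam) m ->
  cheb (cell_trace s1 s2 mu) m.+1 = (3 - mu * s1) * cheb (cell_trace s1 s2 mu) m ->
  mu = lam.
Proof.
wlog lm : lam mu / lam < mu => [th|].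
  move=> *; have [lm|lm|//] := ltgtP lam mu; first exact: (th lam mu).
  by apply/esym; apply: (th mu lam).
move=> s1_gt0 s12 l2 l1 h2 h1 el em; have s2_gt0 : 0 < s2 by lra.
(* The larger root lies below [lambda_star], so both lie where the trace increases. *)
have [mu_lt _] := cheb_root_dist s1_gt0 s12 h2 h1 em.
have /andP[_ star_lt] := lambda_star_bounds s1_gt0 s12.
have st := cell_trace_homo s1_gt0 s2_gt0 lm (ltW (lt_trans mu_lt star_lt)).
have s_gt2 := cell_trace_gt2 l2 l1.
have := cheb_ratio_homo m (ltW s_gt2) (ltW st).
rewrite el em; case: m el em => [|n] el em.
  by move: el; rewrite cheb0 cheb1 mulr0 => /eqP; rewrite oner_eq0.
have := mulr_gt0 (cheb_gt0 n (ltW s_gt2)) (cheb_gt0 n (ltW (lt_trans s_gt2 st))).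
move: (cheb _ _) (cheb _ _) => x y xy.
have : (mu - lam) * s1 > 0 by rewrite mulr_gt0 // subr_gt0.
by nra.
Qed.

(** The difference of the two sides is 1 - 2m (s2 - s1) / s2 at 2/s2, negative by the condition on
    [m], and 1 at 2/s1. *)
Lemma cheb_root_exists {R : realType} {s1 s2 : R} {m : nat} :
  0 < s1 -> s1 < s2 -> s2 < 2 * m%:R * (s2 - s1) ->
  exists lam : R, [/\ 2 < lam * s2, lam * s1 < 2 &
    cheb (cell_trace s1 s2 lam) m.+1 = (3 - lam * s1) * cheb (cell_trace s1 s2 lam) m].
Proof.
move=> s1_gt0 s12 m_large; have s2_gt0 : 0 < s2 by lra.
(* Instantiating [cheb] over the polynomial ring makes the polynomial intermediate value theorem
   applicable. *)
pose T : {poly R} := cell_trace s1%:P s2%:P 'X.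
pose H : {poly R} := cheb T m.+1 - (3%:P - 'X * s1%:P) * cheb T m.
have chebT x n : (cheb T n).[x] = cheb (cell_trace s1 s2 x) n.
  rewrite -/(horner_eval x _) rmorph_cheb; congr cheb.
  by rewrite /= /horner_eval /T /cell_trace !hornerE.
have HE x : H.[x] = cheb (cell_trace s1 s2 x) m.+1
                    - (3 - x * s1) * cheb (cell_trace s1 s2 x) m.
  by rewrite /H !hornerE !chebT.
have tl : cell_trace s1 s2 (2 / s2) = 2.
  by rewrite /cell_trace; field; rewrite !lt0r_neq0.
have tr : cell_trace s1 s2 (2 / s1) = 2.
  by rewrite /cell_trace; field; rewrite !lt0r_neq0.
have Hl : H.[2 / s2] < 0.
  rewrite HE tl !cheb2 -natr1 -(ltr_pM2l s2_gt0) mulr0.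
  have -> : s2 * (m%:R + 1 - (3 - 2 / s2 * s1) * m%:R) = s2 - 2 * m%:R * (s2 - s1).
    by field; rewrite !lt0r_neq0.
  by lra.
have Hr : 0 < H.[2 / s1].
  by rewrite HE tr !cheb2 -natr1 divfK ?lt0r_neq0 //; lra.
have lr : 2 / s2 <= 2 / s1 by rewrite ler_pM2l // lef_pV2 // ltW.
have [|lam /andP[lam_ge lam_le] /rootP Hlam] := @poly_ivt _ H _ _ lr.
  by rewrite !ltW.
exists lam; split.
- rewrite -ltr_pdivrMr // lt_neqAle lam_ge andbT.
  by apply: contraTneq Hl => ->; rewrite Hlam ltxx.
- rewrite -ltr_pdivlMr // lt_neqAle lam_le andbT.
  by apply: contraTneq Hr => <-; rewrite Hlam ltxx.
- by apply/eqP; rewrite -subr_eq0 -HE Hlam.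
Qed.

(** * Exponential convergence of eigenvalues and frequencies *)

(** Factor x - x0 as a difference of squares and bound the sum of the roots below by sqrt x0. *)
Lemma sqrtr_dist {R : rcfType} (x x0 : R) : 0 <= x -> 0 < x0 ->
  `|Num.sqrt x - Num.sqrt x0| <= `|x - x0| / Num.sqrt x0.
Proof.
move=> x_ge0 x0_gt0; have r0 : 0 < Num.sqrt x0 by rewrite sqrtr_gt0.
rewrite ler_pdivlMr // -{2}(sqr_sqrtr x_ge0) -{3}(sqr_sqrtr (ltW x0_gt0)).
rewrite subr_sqr normrM ler_wpM2l // ger0_norm; last by rewrite addr_ge0 ?sqrtr_ge0.
by rewrite lerDr sqrtr_ge0.
Qed.

Theorem mainTheorem9 (R : realType) (s1 s2 : R) :
  0 < s1 -> s1 < s2 ->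
  exists (N0 : nat) (A B : R), 0 < A /\ 0 < B /\
    2 / s2 < lambda_star s1 s2 < 2 / s1 /\
    (forall m : nat, (1 <= m)%N -> (N0 <= 4 * m + 1)%N ->
       (exists lam : R, [/\ 2 / s2 < lam < 2 / s1,
                            eigenvalue (defect_cap_matrix s1 s2 m) lam &
                            forall mu : R, 2 / s2 < mu < 2 / s1 ->
                              eigenvalue (defect_cap_matrix s1 s2 m) mu -> mu = lam])
       /\ (forall lam : R, 2 / s2 < lam < 2 / s1 ->
             eigenvalue (defect_cap_matrix s1 s2 m) lam ->
             `|lam - lambda_star s1 s2| < A * expR (- B * (4 * m + 1)%:R))) /\
    (forall vb delta : R, 0 < vb -> 0 < delta ->
       exists A' : R, 0 < A' /\
         forall m : nat, (1 <= m)%N -> (N0 <= 4 * m + 1)%N ->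
         forall lam : R, 2 / s2 < lam < 2 / s1 ->
           eigenvalue (defect_cap_matrix s1 s2 m) lam ->
           `|vb * Num.sqrt (delta * lam) - vb * Num.sqrt (delta * lambda_star s1 s2)|
             < A' * expR (- B * (4 * m + 1)%:R)).
Proof.
move=> s1_gt0 s12; have s2_gt0 : 0 < s2 by lra.
have /andP[star_gt star_lt] := lambda_star_bounds s1_gt0 s12.
set star := lambda_star s1 s2 in star_gt star_lt *.
have ab : s2^-1 < s1^-1 by rewrite ltf_pV2.
have star_gt0 : 0 < star by apply: lt_trans star_gt; rewrite divr_gt0.
have gapE lam : 2 / s2 < lam < 2 / s1 -> 2 < lam * s2 /\ lam * s1 < 2.
  by case/andP; rewrite ltr_pdivrMr // ltr_pdivlMr.
have star_in : 2 / s2 < star < 2 / s1 by rewrite star_gt; lra.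
have [star2 star1] := gapE _ star_in.
pose K := s2 / (s2 ^+ 2 - s1 ^+ 2).
have K_gt0 : 0 < K by rewrite divr_gt0 //; nra.
(* A point strictly between the gap edge and [star]; from there up to [star] the trace is at least
   [tau0 > 2]. *)
pose lam0 := (2 / s2 + star) / 2.
pose tau0 := cell_trace s1 s2 lam0.
have tau0_gt2 : 2 < tau0.
  by have [] := gapE lam0 _; [rewrite /lam0; lra | exact: cell_trace_gt2].
pose kap := ln (tau0 - 1).
have kap_gt0 : 0 < kap by rewrite ln_gt0 //; lra.
(* The first term ensures existence of a root, the second forces roots above [lam0]. *)
pose x := s2 / (2 * (s2 - s1)) + K / (star - lam0).
pose m0 := Num.bound x.
have x1_ge0 : 0 < s2 / (2 * (s2 - s1)) by rewrite divr_gt0 //; lra.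
have lam0_lt : 0 < star - lam0 by rewrite /lam0; lra.
have x2_ge0 : 0 < K / (star - lam0) by rewrite divr_gt0.
have m_gt m : (4 * m0 + 1 <= 4 * m + 1)%N -> x < m%:R.
  rewrite leq_add2r leq_pmul2l // => m0m.
  apply: lt_le_trans (_ : m0%:R <= _); last by rewrite ler_nat.
  by apply: archi_boundP; rewrite addr_ge0 // ltW.
have close m lam : (1 <= m)%N -> (4 * m0 + 1 <= 4 * m + 1)%N ->
    2 / s2 < lam < 2 / s1 -> eigenvalue (defect_cap_matrix s1 s2 m) lam ->
    `|lam - star| < K * expR (3 * kap) * expR (- (kap / 2) * (4 * m + 1)%:R).
  move=> m1 /m_gt xm /gapE[l2 l1] /(eigenvalue_gapP s1_gt0 s2_gt0 m1 l2 l1) e.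
  have [lam_lt dist] := cheb_root_dist s1_gt0 s12 l2 l1 e.
  rewrite -/star -/K in lam_lt dist.
  rewrite distrC gtr0_norm ?subr_gt0 //.
  have t_gt2 := cell_trace_gt2 l2 l1.
  (* The crude bound suffices: (star - lam) m <= (star - lam) p_m^2 <= K. *)
  have lam_gt : lam0 < lam.
    have pm := cheb_ge_nat m (ltW t_gt2).
    have m_ge1 : 1 <= m%:R :> R by rewrite ler1n.
    have : K < m%:R * (star - lam0).
      by rewrite -ltr_pdivrMr //; apply: lt_trans xm; rewrite /x ltrDr.
    have : (star - lam) * m%:R <= K.
      apply: le_trans dist; rewrite ler_wpM2l ?subr_ge0 ?(ltW lam_lt) //; nra.
    by move=> h1 h2; have := le_lt_trans h1 h2; rewrite mulrC ltr_pM2l; lra.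
  have t_ge := cell_trace_homo s1_gt0 s2_gt0 lam_gt (ltW (lt_trans lam_lt star_lt)).
  case: m m1 e dist {xm} => // n _ _ dist.
  have p_ge : expR (n%:R * kap) <= cheb (cell_trace s1 s2 lam) n.+1.
    apply: le_trans (cheb_ge_expr n (ltW t_gt2)).
    rewrite expRM_natl lnK ?posrE; last by lra.
    by rewrite lerXn2r ?nnegrE; rewrite -/tau0 in t_ge; lra.
  have : (star - lam) * expR (2 * n%:R * kap) <= K.
    apply: le_trans dist; rewrite ler_wpM2l ?subr_ge0 ?(ltW lam_lt) //.
    have -> : 2 * n%:R * kap = n%:R * kap + n%:R * kap by ring.
    by rewrite expRD -expr2 lerXn2r ?nnegrE ?expR_ge0 // (le_trans (expR_ge0 _) p_ge).
  rewrite -ler_pdivlMr ?expR_gt0 // -expRN => /le_lt_trans; apply.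
  (* With m = n + 1, the exponent 3 kap - (kap / 2)(4m + 1) equals kap / 2 - 2 n kap, which exceeds
     -2 n kap strictly. *)
  rewrite -[ltRHS]mulrA -expRD ltr_pM2l // ltr_expR natrD natrM -(natr1 n).
  by lra.
exists (4 * m0 + 1)%N, (K * expR (3 * kap)), (kap / 2).
split; first by rewrite mulr_gt0 ?expR_gt0.
split; first by rewrite divr_gt0.
split=> //; split.
  move=> m m1 mN; split; last by move=> lam; apply: close.
  have m_large : s2 < 2 * m%:R * (s2 - s1).
    have : s2 / (2 * (s2 - s1)) < m%:R.
      by apply: lt_trans (m_gt m mN); rewrite /x ltrDl.
    by rewrite ltr_pdivrMr; lra.
  have [lam [l2 l1 e]] := cheb_root_exists s1_gt0 s12 m_large.
  exists lam; split.
  + by rewrite ltr_pdivrMr // ltr_pdivlMr // l2.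
  + exact/(eigenvalue_gapP s1_gt0 s2_gt0 m1 l2 l1).
  + move=> mu /gapE[h2 h1] /(eigenvalue_gapP s1_gt0 s2_gt0 m1 h2 h1) emu.
    exact: cheb_root_unique s1_gt0 s12 l2 l1 h2 h1 e emu.
move=> vb delta vb_gt0 delta_gt0.
have d_gt0 : 0 < delta * star by rewrite mulr_gt0.
have c_gt0 : 0 < vb * delta / Num.sqrt (delta * star).
  by rewrite divr_gt0 ?sqrtr_gt0 // mulr_gt0.
(* The first factor is the Lipschitz constant that [sqrtr_dist] gives at [delta * star]. *)
exists (vb * delta / Num.sqrt (delta * star) * (K * expR (3 * kap))).
split; first exact: mulr_gt0 c_gt0 (mulr_gt0 K_gt0 (expR_gt0 _)).
move=> m m1 mN lam lam_in ev.
have lam_ge0 : 0 <= delta * lam.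
  by have [l2 _] := gapE _ lam_in; rewrite mulr_ge0 ?ltW //; nra.
rewrite -mulrBr normrM (gtr0_norm vb_gt0).
apply: (le_lt_trans (ler_wpM2l (ltW vb_gt0) (sqrtr_dist _ _ lam_ge0 d_gt0))).
rewrite -mulrBr normrM (gtr0_norm delta_gt0).
have -> : forall y z : R, vb * (delta * y / z) = vb * delta / z * y by move=> y z; ring.
by rewrite -[ltRHS]mulrA ltr_pM2l //; apply: close.
Qed.
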